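(* Let $a\ge 1$ and $d\ge 1$ be integers. If all prime factors of $a$ are also factors of $2d$, then the sequence $\{SG_{a,2d}(an)\}_{n\ge 1}$ is $2d$-automatic.
   Context: For a finite set $X$ of non-negative integers, $\mathrm{mex}(X)$ denotes the smallest non-negative integer not in $X$. For integers $a\ge 1$, $b\ge 2$, $G_{a,b}(n)$ is the two-player impartial game starting from the total $n\ge 1$ in which players alternately replace the current total $m$ either by $m-a$ (allowed only when $m-a\ge 1$) or by $\lceil m/b\rceil$; the total $1$ is terminal (the player who says $1$ wins). Its Sprague--Grundy function $SG_{a,b}$ on the positive integers is given by $SG_{a,b}(1)=0$ and, for $n\ge 2$, $SG_{a,b}(n)$ is the mex of the set of Sprague--Grundy values of the totals reachable from $n$ in one move; thus $SG_{a,b}(n)=\mathrm{mex}\{SG_{a,b}(n-a),SG_{a,b}(\lceil n/b\rceil)\}$ for $n>a$, and $SG_{a,b}(n)=\mathrm{mex}\{SG_{a,b}(\lceil n/b\rceil)\}$ for $2\le n\le a$. A sequence $\{a_n\}$ is $k$-automatic if there is a deterministic finite automaton with output (DFAO) that, when given the base-$k$ digits of $n$, returns the value $a_n$. *)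

(* Defs.v *)
From mathcomp Require Import all_boot.
Set Implicit Arguments.
Unset Strict Implicit.
Unset Printing Implicit Defensive.

Lemma ex_notin (X : seq nat) : exists m, m \notin X.
Proof.
exists (\max_(x <- X) x).+1; apply/negP => maxX.
by have := @leq_bigmax_seq _ _ predT id _ maxX isT; rewrite ltnn.
Qed.

Definition mex (X : seq nat) : nat := ex_minn (ex_notin X).

Definition ceil_div (n b : nat) : nat := (n + b.-1) %/ b.

Lemma ceil_divP n b m : 0 < b -> (ceil_div n b <= m) = (n <= m * b).
Proof.
case: b => // b _; rewrite /ceil_div -ltnS ltn_divLR //= mulSn.
by rewrite [n + b]addnC addSn ltnS leq_add2l.
Qed.

(* The total 1 is terminal by decree: without the guard it would have the     *)
(* move 1 -> ceil (1 / b) = 1.  The total 0 never occurs in a play.           *)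
Definition moves (a b n : nat) : seq nat :=
  if n <= 1 then [::]
  else (if a < n then [:: n - a] else [::]) ++ [:: ceil_div n b].

Lemma moves_ltn a b n m :
  0 < a -> 1 < b -> m \in moves a b n -> 0 < m < n.
Proof.
move=> a0 b1; rewrite /moves; case: (leqP n 1) => // n1.
have b0 : 0 < b by exact: ltnW.
rewrite mem_cat inE => /orP[|/eqP->].
  case: ifP => // an; rewrite inE => /eqP->.
  by rewrite subn_gt0 an ltn_subrL a0 (ltnW n1).
rewrite ltnNge ceil_divP // mul0n -ltnNge (ltnW n1) /=.
case: n n1 => [//|n] n1; rewrite ltnS ceil_divP //.
apply: leq_trans (leq_mul (leqnn n) b1); rewrite muln2 -addnn -addn1.
by rewrite leq_add2l.
Qed.

(* Every move decreases the total, so a recursion depth of n is enough to     *)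
(* evaluate the total n; the recursion SG_mex below characterizes SG.         *)
Fixpoint SG_rec (depth a b n : nat) : nat :=
  if depth is k.+1 then mex [seq SG_rec k a b m | m <- moves a b n] else 0.

Definition SG (a b n : nat) : nat := SG_rec n a b n.

Lemma SG_recE k a b n : 0 < a -> 1 < b -> 0 < n <= k ->
  SG_rec k a b n = SG a b n.
Proof.
move=> a0 b1; rewrite /SG.
suff H j l : 0 < n <= j -> n <= l -> SG_rec j a b n = SG_rec l a b n.
  by move=> nk; apply: H.
elim: j l n => [|j IH] [|l] n; rewrite ?leqn0 ?lt0n; try by case: eqP.
move=> /andP[_ nj] nl /=; congr mex; apply/eq_in_map => m mn.
have /andP[m0 mltn] := moves_ltn a0 b1 mn.
by apply: IH; rewrite ?m0 /= -ltnS (leq_trans mltn).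
Qed.

Lemma SG_mex a b n : 0 < a -> 1 < b -> 0 < n ->
  SG a b n = mex [seq SG a b m | m <- moves a b n].
Proof.
move=> a0 b1 n0; rewrite {1}/SG; case: n n0 => // n _ /=; congr mex.
apply/eq_in_map => m mn; have /andP[m0 mltn] := moves_ltn a0 b1 mn.
by apply: SG_recE => //; rewrite m0.
Qed.

Lemma SG1 a b : 0 < a -> 1 < b -> SG a b 1 = 0.
Proof.
move=> a0 b1; rewrite SG_mex //= /mex; case: ex_minnP => m _ mmin.
by apply/eqP; rewrite -leqn0 mmin.
Qed.

Record dfao (k : nat) (T : Type) := DFAO {
  dfao_state : finType;
  dfao_init : dfao_state;
  dfao_trans : dfao_state -> 'I_k -> dfao_state;
  dfao_out : dfao_state -> T
}.

Definition dfao_run k T (A : dfao k T) (w : seq 'I_k) : T :=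
  dfao_out (foldl (@dfao_trans k T A) (dfao_init A) w).

Definition word_val k (w : seq 'I_k) : nat :=
  foldl (fun m (c : 'I_k) => m * k + c) 0 w.

(* Most significant digit first, without leading zeros; 0 is the empty word.  *)
Definition base_digits k (n : nat) (w : seq 'I_k) : bool :=
  (word_val w == n) && (if w is c :: _ then 0 < c else true).

Lemma base_digits_exists k n : 1 < k -> exists w : seq 'I_k, base_digits n w.
Proof.
move=> k1; have k0 : 0 < k by exact: ltnW.
have [m] := ubnP n; elim: m n => // m IH n; rewrite ltnS => nm.
have [->|n0] := posnP n; first by exists [::].
have [|w /andP[/eqP wn wh]] := IH (n %/ k).
  by apply: leq_trans nm; rewrite ltn_Pdiv.
exists (rcons w (Ordinal (ltn_pmod n k0))); apply/andP; split.
  by rewrite /word_val foldl_rcons -/(word_val w) wn -divn_eq.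
case: w wn wh => //= nk _; rewrite lt0n; apply: contraTneq n0 => nk0.
by rewrite (divn_eq n k) -nk nk0.
Qed.

Lemma base_digits_uniq k n (w w' : seq 'I_k) :
  base_digits n w -> base_digits n w' -> w = w'.
Proof.
have pos (v : seq 'I_k) c : (if rcons v c is x :: _ then 0 < x else true) ->
    0 < word_val (rcons v c).
  have k0 : 0 < k by apply: leq_ltn_trans (ltn_ord c).
  elim/last_ind: v c => [|v e IH] c vh; first by rewrite /word_val /= mul0n.
  rewrite /word_val foldl_rcons addn_gt0 muln_gt0 k0 andbT IH //.
  by case: v vh {IH}.
elim/last_ind: w n w' => [|w c IH] n w'.
  move=> /andP[/eqP<- _]; case/lastP: w' => // w' c /andP[/eqP w0 wh].
  by have := pos _ _ wh; rewrite w0.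
move=> /andP[/eqP wn wh]; case/lastP: w' => [|w' c'] /andP[/eqP wn' wh'].
  by have := pos _ _ wh; rewrite wn -wn'.
have k0 : 0 < k by apply: leq_ltn_trans (ltn_ord c).
move: wn wn'; rewrite /word_val !foldl_rcons -!/(word_val _) => <- e.
have ec : c' = c.
  by apply: val_inj; have := congr1 (modn^~ k) e;
     rewrite /= !modnMDl !modn_small.
have ew : word_val w' = word_val w.
  by have := congr1 (divn^~ k) e; rewrite /= !divnMDl // !divn_small ?addn0.
rewrite ec; congr rcons; apply: (IH (word_val w)); rewrite /base_digits.
  by rewrite eqxx; case: (w) wh.
by rewrite ew eqxx; case: (w') wh'.
Qed.

(* For sequences indexed by the positive integers: the value u 0 plays no     *)
(* role.                                                                      *)
Definition automatic (k : nat) (T : Type) (u : nat -> T) : Prop :=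
  exists A : dfao k T, forall (n : nat) (w : seq 'I_k),
    0 < n -> base_digits n w -> dfao_run A w = u n.

(* Main.v *)
(** Call [SG(ceil (n / b))] the input at [n].  If [p] divides both [a] and
    [b], then the totals of a block [p (j - 1) < n <= p j] see the same input,
    and they still do after any number of shifts by [a].  An input [0] followed
    by a nonzero input forces the value [0], whatever the earlier values were,
    and this pattern recurs along every residue class modulo [a]; so [SG] is
    eventually constant on such blocks, and [n |-> SG(p n)] eventually satisfies
    the recurrence with [a / p] in place of [a].  Removing all prime factors of
    [a], we see that [F n = SG(a n)] eventually satisfies
    [F n = mex {F(n - 1), F(ceil (n / b))}].  As [b] is even, from some point on
    [F(b m)] is [3 - F m], or [3 - F(m - 1)] if [F m = 0], so that [F] around
    [b m + c] is a function of [c] and of [F] on the window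
    [m - 2, ..., m + 2]. *)
Require Import Defs.
From mathcomp Require Import all_boot.
From mathcomp Require Import zify.

Set Implicit Arguments.
Unset Strict Implicit.
Unset Printing Implicit Defensive.

Lemma mex2E x y : mex [:: x; y] =
  if (x == 0) || (y == 0) then (if (x == 1) || (y == 1) then 2 else 1) else 0.
Proof.
rewrite /mex; case: ex_minnP => m; rewrite !inE => mP mmin.
have := mmin 0; have := mmin 1; have := mmin 2; rewrite !inE.
case: ifP; last by lia.
by case: ifP; lia.
Qed.

(** * Quotients rounded up *)

Lemma ceil_div_unique n b q :
  0 < b -> (forall m, (q <= m) = (n <= m * b)) -> ceil_div n b = q.
Proof.
move=> b0 qP; apply/eqP; rewrite eqn_leq ceil_divP // -qP leqnn /=.
by rewrite qP -ceil_divP.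
Qed.

Lemma ceil_div_addM n b i : 0 < b -> ceil_div (n + i * b) b = ceil_div n b + i.
Proof. by move=> b0; rewrite /ceil_div addnAC addnC divnMDl // addnC. Qed.

Lemma ceil_divMD m s b : 0 < s <= b -> ceil_div (b * m + s) b = m.+1.
Proof.
move=> sb; apply: ceil_div_unique => [|q]; first lia.
by case: (ltnP m q) => mq; symmetry; [apply/idP|apply/negP]; nia.
Qed.

Lemma ltn_ceil_div n m b : 0 < b -> m * b < n -> m < ceil_div n b.
Proof. by move=> b0; rewrite !ltnNge ceil_divP. Qed.

(** Multiples of [b] are multiples of [p], so rounding [k] up to a multiple of [p] skips none of
    them. *)
Lemma ceil_div_round k p b :
  0 < p -> 0 < b -> p %| b -> ceil_div (p * ceil_div k p) b = ceil_div k b.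
Proof.
move=> p0 b0 /dvdnP[c bE]; apply: ceil_div_unique => // m.
by rewrite ceil_divP // bE mulnA [p * _]mulnC leq_pmul2r // ceil_divP.
Qed.

Lemma ceil_div_ceil_div_mul n p b :
  0 < p -> 0 < b -> ceil_div (ceil_div (p * n) b) p = ceil_div n b.
Proof.
move=> p0 b0; apply: ceil_div_unique => // m.
by rewrite !ceil_divP // [p * n]mulnC mulnAC leq_pmul2r.
Qed.

Lemma ex_zero_then_nonzero (z : nat -> nat) s t :
  s < t -> z s = 0 -> z t != 0 ->
  exists i, [/\ s <= i, i < t, z i = 0 & z i.+1 != 0].
Proof.
elim: t => // t IH; rewrite ltnS leq_eqVlt => /orP[/eqP<- zs zt|st zs zt].
  by exists s.
have [zt0|zt0] := eqVneq (z t) 0; first by exists t; split=> //; exact: ltnW.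
by have [i [? ? ? ?]] := IH st zs zt0; exists i; split=> //; exact: ltnW.
Qed.

(** * Eventual mex recurrences and their scaling *)

Definition mex_rec_from N a b (f : nat -> nat) :=
  forall n, N < n -> f n = mex [:: f (n - a); f (ceil_div n b)].

Section MexRec.

Variables (N a b : nat) (f : nat -> nat).
Hypotheses (a0 : 0 < a) (b1 : 1 < b) (fP : mex_rec_from N a b f).

Let b0 : 0 < b := ltnW b1.

Lemma mex_rec_lt3 n : N < n -> f n < 3.
Proof. by move=> /fP->; rewrite mex2E; do ?case: ifP. Qed.

Lemma mex_rec_zero_nonzero k : N <= k -> f k = 0 -> f (k + a) != 0.
Proof.
move=> Nk fk; rewrite fP ?addnK ?mex2E ?fk /=; last lia.
by case: ifP.
Qed.

(* Otherwise the inputs at [k + a] and [k + a + a * b], which are values of    *)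
(* [f] at totals differing by [a], would both be [0].                         *)
Lemma mex_rec_ex_zero k : N * b < k -> exists2 i, i <= b.+1 & f (k + i * a) = 0.
Proof.
move=> Nk; case: (boolP [exists i : 'I_b.+2, f (k + i * a) == 0]).
  by move=> /existsP[i /eqP fi]; exists i; rewrite // -ltnS.
rewrite negb_exists => /forallP nz.
have Nle : N < k by nia.
have input0 i : i <= b -> f (ceil_div (k + i.+1 * a) b) = 0.
  move=> ib; have i1 : i < b.+2 by lia.
  have i2 : i.+1 < b.+2 by lia.
  have /= := nz (Ordinal i1); have /= := nz (Ordinal i2); rewrite fP; last lia.
  rewrite {1}mulSn [a + _]addnC addnA addnK mex2E => + /negPf fi0.
  by rewrite fi0 /=; case: (f (ceil_div _ b) =P 0).
have := input0 b (leqnn _).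
rewrite mulSn addnA [b * a]mulnC ceil_div_addM //.
have Nk1 : N < ceil_div (k + a) b by apply: ltn_ceil_div => //; lia.
have := input0 0 isT; rewrite mul1n => /(mex_rec_zero_nonzero (ltnW Nk1)).
by move=> /negPf nz1 /eqP; rewrite nz1.
Qed.

(** Every [b]-th input along [k + t * a] runs through [f] in steps of [a], where a zero is followed
    by a nonzero value; the inputs in between must change somewhere. *)
Lemma mex_rec_ex_pattern k : N * b * b < k ->
  exists t, [/\ t < b * b.+2, f (ceil_div (k + t * a) b) = 0
              & f (ceil_div (k + t.+1 * a) b) != 0].
Proof.
move=> Nk; pose z t := f (ceil_div (k + t * a) b).
have zb i : z (i * b) = f (ceil_div k b + i * a).
  by rewrite /z mulnAC ceil_div_addM.
have Nk1 : N * b < ceil_div k b by exact: ltn_ceil_div.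
have [i ib fi] := @mex_rec_ex_zero (ceil_div k b) Nk1.
have [|||t [_ tb zt zt1]] := @ex_zero_then_nonzero z (i * b) (i.+1 * b).
- by rewrite ltn_pmul2r.
- by rewrite zb.
- by rewrite zb mulSn [a + _]addnC addnA mex_rec_zero_nonzero //; nia.
by exists t; split=> //; nia.
Qed.

(** Going back [L] shifts leaves room for the pattern. Its zero input makes the values in both
    progressions nonzero, so its nonzero input then makes both [0]; from there equal inputs keep
    them equal. *)
Lemma mex_rec_round p : 0 < p -> p %| a -> p %| b ->
  exists N1, forall k, N1 < k -> f (p * ceil_div k p) = f k.
Proof.
move=> p0 pa pb; pose L := b * b.+2.
exists (N * b * b + L * a) => k' Nk'; pose k := k' - L * a.
have kE : k' = k + L * a by rewrite /k; lia.
have Nk : N * b * b < k by rewrite /k; lia.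
have [c aE] := dvdnP pa.
pose K := p * ceil_div k p.
have kK : k <= K by rewrite /K mulnC -ceil_divP.
have KE t : p * ceil_div (k + t * a) p = K + t * a.
  by rewrite aE mulnA ceil_div_addM // mulnDr; congr (_ + _); rewrite mulnC.
have input_eq t : ceil_div (K + t * a) b = ceil_div (k + t * a) b.
  by rewrite -KE ceil_div_round.
have NK : N < k by nia.
have step n t : k <= n ->
    f (n + t.+1 * a) = mex [:: f (n + t * a); f (ceil_div (n + t.+1 * a) b)].
  by move=> kn; rewrite fP ?mulSn; [congr (mex [:: f _; _])|]; lia.
have [t [tL zt zt1]] := mex_rec_ex_pattern Nk.
have nz n : k <= n -> f (ceil_div (n + t * a) b) = 0 -> f (n + t * a) != 0.
  by move=> kn z0; rewrite fP ?z0 ?mex2E ?orbT; [case: ifP|lia].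
have merged : f (K + t.+1 * a) = f (k + t.+1 * a).
  rewrite !step // !input_eq !mex2E (negPf zt1).
  by rewrite !(negPf (nz _ _ _)) // input_eq.
have merged_after s : t < s -> f (K + s * a) = f (k + s * a).
  elim: s => // s IH; rewrite ltnS leq_eqVlt => /orP[/eqP<-//|/IH es].
  by rewrite !step // input_eq es.
by rewrite kE KE merged_after.
Qed.

End MexRec.

Lemma mex_rec_scale N a b p f : 0 < a -> 1 < b -> 0 < p -> p %| b ->
  mex_rec_from N (p * a) b f ->
  exists N1, mex_rec_from N1 a b (fun n => f (p * n)).
Proof.
move=> a0 b1 p0 pb fP; have b0 := ltnW b1.
have pa0 : 0 < p * a by rewrite muln_gt0 p0.
have [N1 fround] := mex_rec_round pa0 b1 fP p0 (dvdn_mulr _ (dvdnn p)) pb.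
exists (N + N1 * b) => n Nn; rewrite fP; last nia.
rewrite mulnBr -(fround (ceil_div _ _)) ?ceil_div_ceil_div_mul //.
by apply: ltn_ceil_div => //; nia.
Qed.

Lemma mex_rec_scale_all N a b f : 0 < a -> 1 < b ->
  (forall p, prime p -> p %| a -> p %| b) -> mex_rec_from N a b f ->
  exists N1, mex_rec_from N1 1 b (fun n => f (a * n)).
Proof.
move=> + b1; have [m] := ubnP a; elim: m a N f => // m IH a N f.
rewrite ltnS => am a0 apr fP.
have [a1|a_neq1] := eqVneq a 1.
  by rewrite a1 in fP *; exists N => n Nn; rewrite !mul1n fP.
have a_gt1 : 1 < a by lia.
pose p := pdiv a; have p_pr : prime p := pdiv_prime a_gt1.
have pa : p %| a := pdiv_dvd a.
have aE : p * (a %/ p) = a by rewrite mulnC divnK.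
have c0 : 0 < a %/ p by rewrite divn_gt0 ?prime_gt0 // dvdn_leq.
have [N1 gP] : exists N1, mex_rec_from N1 (a %/ p) b (fun n => f (p * n)).
  by apply: (@mex_rec_scale N) => //; rewrite ?prime_gt0 ?aE //; exact: apr.
have [|q q_pr qc|N2 hP] := IH (a %/ p) N1 _ _ c0 _ gP.
- by apply: leq_trans am; rewrite ltn_Pdiv // prime_gt1.
- by apply: apr => //; rewrite -aE dvdn_mull.
by exists N2 => n /hP; rewrite !mulnA aE.
Qed.

(** * Values at multiples of an even base *)

Section EvenBase.

Variables (N d : nat) (F : nat -> nat).
Hypotheses (d0 : 0 < d) (FP : mex_rec_from N 1 (2 * d) F).

Let b := 2 * d.
Let b1 : 1 < b. Proof. by rewrite /b; lia. Qed.

Let step y x := mex [:: x; y].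

Lemma mex_rec_block m s :
  N <= b * m -> s <= b -> F (b * m + s) = iter s (step (F m.+1)) (F (b * m)).
Proof.
move=> Nm; elim: s => [|s IH] sb; first by rewrite addn0.
by rewrite FP ?ceil_divMD ?addnS ?subn1 /= ?IH //; lia.
Qed.

(** The first step gives [0], then [3 - y] and [0] alternate; [b] is even. *)
Lemma iter_step_nonzero x y : y < 3 -> x != 0 -> y != 0 ->
  iter b (step y) x = 3 - y.
Proof.
move=> y3 xn0 yn0; rewrite /b; case: d d0 => // e _.
rewrite mul2n -addnn; elim: e => [|e IH].
  by case: y yn0 y3 x xn0 => [|[|[|]]] // _ _ [|x] // _; rewrite /step /= !mex2E.
rewrite addnS addSn 2!iterS IH.
by case: y yn0 y3 {IH} => [|[|[|]]] // _ _; rewrite /step !mex2E.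
Qed.

(** Each step swaps [1] and [2]. *)
Lemma iter_step_zero x : x != 0 -> x < 3 -> iter b (step 0) x = x.
Proof.
move=> xn0 x3; rewrite /b mul2n -addnn; elim: d => // e IH.
rewrite addnS addSn 2!iterS IH.
by case: x xn0 x3 {IH} => [|[|[|]]] // _ _; rewrite /step !mex2E.
Qed.

Lemma iter_step_from_zero x : iter b (step 0) x != 0.
Proof.
rewrite /b; case: d d0 => // e _; rewrite mul2n doubleS iterS.
by rewrite /step mex2E orbT; case: ifP.
Qed.

Lemma mex_rec_multiple_neq0 :
  exists M, forall m, M <= m -> F (b * m) != 0.
Proof.
have [i _ Fi] := mex_rec_ex_zero (ltn0Sn 0) b1 FP (ltnSn (N * b)).
set M := _ + _ in Fi; exists M.
have NM : N * b < M by rewrite /M; lia.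
have blockE m : M <= m.+1 -> F (b * m.+1) = iter b (step (F m.+1)) (F (b * m)).
  by move=> Mm; rewrite -mex_rec_block // ?mulnSr //; nia.
(* A zero input makes the end of its block nonzero, which starts the induction at [M]; under a
   nonzero input, nonzeroness passes from the start of the block to its end. *)
move=> m; elim: m => [|m IH] Mm; first by lia.
rewrite blockE //; have [->|Fm] := eqVneq (F m.+1) 0.
  exact: iter_step_from_zero.
have F3 : F m.+1 < 3 by apply: mex_rec_lt3 FP _ _; nia.
move: Mm; rewrite leq_eqVlt => /orP[/eqP Mm|Mm].
  by rewrite -Mm Fi in Fm.
by rewrite iter_step_nonzero ?IH //; lia.
Qed.

Lemma mex_rec_multiple : exists M, forall m, M <= m ->
  F (b * m.+1) = if F m.+1 == 0 then 3 - F m else 3 - F m.+1.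
Proof.
have [M Mnz] := mex_rec_multiple_neq0.
exists (M + N).+2 => m Mm.
have Flt3 n : N < n -> F n < 3 by exact: mex_rec_lt3 FP n.
have blockE n : M + N < n -> F (b * n.+1) = iter b (step (F n.+1)) (F (b * n)).
  by move=> Mn; rewrite -mex_rec_block // ?mulnSr //; nia.
have nonzeroE n : M + N < n -> F n.+1 != 0 -> F (b * n.+1) = 3 - F n.+1.
  move=> Mn Fn; rewrite blockE // iter_step_nonzero ?Flt3 ?Mnz //; lia.
have [F0|Fn0] := eqVneq; last by rewrite nonzeroE //; lia.
(* The zero input preserves [F (b * m)], and [F m] is nonzero since no two consecutive values
   vanish. *)
rewrite blockE ?F0; last lia.
rewrite iter_step_zero ?Mnz ?Flt3 //; try nia.
case: m Mm F0 => // m Mm F0; apply: nonzeroE; first lia.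
apply/negP => /eqP Fm; have NSm : N <= m.+1 by lia.
by have := mex_rec_zero_nonzero (ltn0Sn 0) b1 FP NSm Fm; rewrite addn1 F0.
Qed.

End EvenBase.

(** * Construction of the automaton *)

Lemma automatic_of_state_map k (T : Type) (u : nat -> T) (S : finType) N
    (W : nat -> S) (next : S -> 'I_k -> S) (out : S -> T) :
  (forall n, N < n -> out (W n) = u n) ->
  (forall m (c : 'I_k), N < m -> W (m * k + c) = next (W m) c) ->
  automatic k u.
Proof.
move=> outP nextP.
(* Prefixes of value at most [N] are stored exactly; beyond [N], further digits never lead back. *)
pose rep n : 'I_N.+1 + S := if n <= N then inl (inord n) else inr (W n).
pose trans (q : 'I_N.+1 + S) (c : 'I_k) : 'I_N.+1 + S :=
  match q with inl m => rep (m * k + c) | inr w => inr (next w c) end.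
pose read (q : 'I_N.+1 + S) := match q with inl m => u m | inr w => out w end.
exists (DFAO (rep 0) trans read) => n w _ /andP[/eqP<- _].
rewrite /dfao_run /=; suff -> : foldl trans (rep 0) w = rep (word_val w).
  by rewrite /rep; case: leqP => [le|/outP//] /=; rewrite inordK.
elim/last_ind: w => // w c IH; rewrite /word_val !foldl_rcons IH -/(word_val w).
rewrite {1}/rep; case: leqP => [le|lt] /=; first by rewrite inordK.
rewrite /rep leqNgt (leq_trans lt) ?nextP //.
by have := ltn_ord c; nia.
Qed.

Lemma mex_rec_automatic N d F : 0 < d -> mex_rec_from N 1 (2 * d) F ->
  automatic (2 * d) F.
Proof.
move=> d0 FP; pose b := 2 * d.
have [M multE] := mex_rec_multiple d0 FP.
pose phi (s x y z : nat) :=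
  iter s (fun v => mex [:: v; z]) (if y == 0 then 3 - x else 3 - y).
have FE m s : M + N <= m -> s < b ->
    F (b * m.+1 + s) = phi s (F m) (F m.+1) (F m.+2).
  by move=> Mm sb; rewrite (mex_rec_block d0 FP) ?multE //; nia.
have Flt3 n : N < n -> F n < 3 by exact: mex_rec_lt3 FP n.
pose W n := [ffun i : 'I_5 => inord (F (n - 2 + i)) : 'I_3].
(* The [i]-th entry of the window around [b * m + c] is [F] at                *)
(* [b * (m - 2) + (b * 2 + c - 2 + i)].                                       *)
pose e c i := b * 2 + c - 2 + i.
pose next (w : {ffun 'I_5 -> 'I_3}) (c : 'I_b) := [ffun i : 'I_5 =>
  let j := e c i %/ b in
  inord (phi (e c i %% b) (w (inord j.-1)) (w (inord j)) (w (inord j.+1)))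
  : 'I_3].
apply: (@automatic_of_state_map _ _ _ _ (M + N).+3 W next
          (fun w => val (w (inord 2)))).
  by move=> n Mn; rewrite ffunE /= !inordK ?subnK ?Flt3 //; lia.
move=> m c Mm; apply/ffunP => i; rewrite !ffunE; congr inord.
have cb := ltn_ord c; have i5 := ltn_ord i.
have b2 : 2 <= b by rewrite /b; lia.
(* The quotient lies in 1, 2, 3, so it and its two neighbours index the window of five. *)
have j_lo : 0 < e c i %/ b by rewrite divn_gt0 /e; lia.
have j_hi : e c i %/ b < 4 by rewrite ltn_divLR /e; lia.
have r_lt : e c i %% b < b by rewrite ltn_mod; lia.
have eE := divn_eq (e c i) b.
move: (_ %/ _) (_ %% _) j_lo j_hi r_lt eE => [|j] // r _ j4 rb eE.
have WE l : l < 5 -> W m (inord l) = F (m - 2 + l) :> nat.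
  by move=> l5; rewrite ffunE !inordK ?Flt3 //; lia.
rewrite !WE //; try lia.
rewrite /= !addnS -FE //; last lia.
by congr F; move: eE; rewrite /e -/b; nia.
Qed.

Theorem theorem2 (a d : nat) (ha : 1 <= a) (hd : 1 <= d)
  (hpr : forall p : nat, prime p -> p %| a -> p %| 2 * d) :
  automatic (2 * d) (fun n : nat => SG a (2 * d) (a * n)).
Proof.
have b1 : 1 < 2 * d by lia.
have SG_rec_from : mex_rec_from a a (2 * d) (SG a (2 * d)).
  move=> n an; rewrite SG_mex ?(leq_trans _ an) // /moves.
  by rewrite leqNgt (leq_ltn_trans ha an) an.
have [N FP] := mex_rec_scale_all ha b1 hpr SG_rec_from.
exact: mex_rec_automatic FP.
Qed.
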